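(* Let $\mathcal{A}$ and $\mathcal{B}$ be generalized Riemann derivatives of orders $m$ and $n$, respectively. Then $\mathcal{B}$-differentiation implies $\mathcal{A}$-differentiation if and only if $m=n$ and there are finitely many real coefficients $U_i$, $V_i$ and non-zero real numbers $u_i$, $v_i$ such that, for every function $f:\mathbb{R}\to\mathbb{R}$ and all $x,h\in\mathbb{R}$, $$\Delta_{\mathcal{A}}^{\epsilon}f(x,h)=\sum_i U_i\,\Delta_{\mathcal{B}}^{\epsilon}f(x,u_ih)\quad\text{and}\quad \Delta_{\mathcal{A}}^{\epsilon'}f(x,h)=\sum_i V_i\,\Delta_{\mathcal{B}}^{\epsilon'}f(x,v_ih),$$ both sums being finite. Here $\epsilon=\epsilon(n)$ and $\epsilon'=\epsilon'(n)$.
   Context: A difference is an expression $\Delta_{\mathcal{A}}f(x,h)=\sum_{i}A_i f(x+a_ih)$ determined by a finite set of real parameters $\mathcal{A}=\{A_1,\ldots,A_p;a_1,\ldots,a_p\}$ with $a_1,\ldots,a_p$ distinct; it is regarded as an operation applied to all functions $f:\mathbb{R}\to\mathbb{R}$. For an integer $n\ge 1$, it is a generalized Riemann difference of order $n$ if the Vandermonde conditions $\sum_i A_i a_i^j=n!\,\delta_{jn}$ hold for $j=0,1,\ldots,n$. The corresponding generalized Riemann derivative of order $n$ (also called the $\mathcal{A}$-derivative, and denoted by $\mathcal{A}$) is $D_{\mathcal{A}}f(x)=\lim_{h\to0}\Delta_{\mathcal{A}}f(x,h)/h^n$; $f$ is $\mathcal{A}$-differentiable at $x$ if this limit exists as a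 finite number. ''$\mathcal{B}$-differentiation implies $\mathcal{A}$-differentiation'' means: for every function $f:\mathbb{R}\to\mathbb{R}$ and every real $x$, if $f$ is $\mathcal{B}$-differentiable at $x$ then $f$ is $\mathcal{A}$-differentiable at $x$. The even and odd components of a difference are $\Delta_{\mathcal{A}}^{ev}f(x,h)=\frac{1}{2}\left(\Delta_{\mathcal{A}}f(x,h)+\Delta_{\mathcal{A}}f(x,-h)\right)$ and $\Delta_{\mathcal{A}}^{odd}f(x,h)=\frac{1}{2}\left(\Delta_{\mathcal{A}}f(x,h)-\Delta_{\mathcal{A}}f(x,-h)\right)$. Set $\epsilon(n)=ev$, $\epsilon'(n)=odd$ if $n$ is even, and $\epsilon(n)=odd$, $\epsilon'(n)=ev$ if $n$ is odd. *)

(* Defs.v *)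
From mathcomp Require Import all_boot all_order all_algebra.
From mathcomp Require Import all_classical all_reals all_analysis.

Set Implicit Arguments.
Unset Strict Implicit.
Unset Printing Implicit Defensive.

Import Order.TTheory GRing.Theory Num.Theory.
Import numFieldNormedType.Exports.

Local Open Scope classical_set_scope.
Local Open Scope ring_scope.

Record difference (R : realType) := Difference {
  dsize : nat;
  coef : 'I_dsize -> R;
  node : 'I_dsize -> R;
  node_inj : injective node
}.

Definition Delta (R : realType) (A : difference R) (f : R -> R) (x h : R) : R :=
  \sum_(i < dsize A) coef i * f (x + node i * h).

Definition Delta_ev (R : realType) (A : difference R) (f : R -> R) (x h : R) : R :=
  2^-1 * (Delta A f x h + Delta A f x (- h)).

Definition Delta_odd (R : realType) (A : difference R) (f : R -> R) (x h : R) : R :=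
  2^-1 * (Delta A f x h - Delta A f x (- h)).

(* The component whose parity is that of n. *)
Definition Delta_eps (R : realType) (n : nat) (A : difference R) :
    (R -> R) -> R -> R -> R :=
  if odd n then Delta_odd A else Delta_ev A.

(* The component whose parity is opposite to that of n. *)
Definition Delta_eps' (R : realType) (n : nat) (A : difference R) :
    (R -> R) -> R -> R -> R :=
  if odd n then Delta_ev A else Delta_odd A.

(* Vandermonde conditions; for j = 0 a zero node contributes 0 ^+ 0 = 1. *)
Definition generalized_Riemann (R : realType) (n : nat) (A : difference R) : Prop :=
  (1 <= n)%N /\
  forall j : nat, (j <= n)%N ->
    \sum_(i < dsize A) coef i * node i ^+ j = n`!%:R * (j == n)%:R.

(* 0^' is the deleted neighbourhood filter at 0; a limit in R is finite. *)
Definition gR_differentiable (R : realType) (n : nat) (A : difference R)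
    (f : R -> R) (x : R) : Prop :=
  exists l : R, Delta A f x h / h ^+ n @[h --> (0 : R)^'] --> l.

Definition differentiation_implies (R : realType) (n : nat) (B : difference R)
    (m : nat) (A : difference R) : Prop :=
  forall (f : R -> R) (x : R),
    gR_differentiable n B f x -> gR_differentiable m A f x.

(* Main.v *)
Require Import Defs.
From mathcomp Require Import all_boot all_order all_algebra.
From mathcomp Require Import all_classical all_reals all_analysis.
From mathcomp Require Import ring.

(** The substance is the direct implication. Since a difference at the base
    point x and step h is the difference at base point 0 and step 1 of the
    function y |-> f (x + y * h), everything takes place at 0, and the required
    identities say that a component of A lies in the span W of the dilates of
    the same component of B, all these being viewed as linear functionals on
    functions.

    Suppose that it does not. A linear form phi that kills W and takes the value
    1 on the component of A (span_or_functional, a consequence of Zorn's lemma)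
    gives a function f y := phi (evaluation at y). Passing to the part of f of
    the right parity and subtracting its value at 0, one gets f with f 0 = 0,
    Delta B f 0 h = 0 for all h and Delta A f 0 1 = 1. This is not yet a
    contradiction, because nothing is known about small steps for A. But the
    nonzero nodes lie in a countable multiplicative subgroup H, and there is t
    in (0, 1) none of whose positive powers belongs to H (independent_scale).
    Differences at 0 only relate values of a function inside one coset of H, and
    its value at 0, so the restriction of f to H can be copied onto the disjoint cosets t^k H, and
    replaced by 0 on the others (spread). The resulting F still satisfies
    Delta B F 0 h = 0 for all h, whereas Delta A F 0 (t^k) = 1 for all k; as the
    order m of A is positive, 1 / t^(km) diverges and F is not A-differentiable
    (component_in_span).

    As for the orders, dilating B does not create nonzero moments of degree less
    than n, while the moment of degree m of A is m!; hence n <= m once the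
    component of A with the parity of m is in the span (span_order_le).
    Conversely, if n < m, the function equal to y^m at the points t^(2k) and to
    0 elsewhere is o(y^n), hence B-differentiable, but the quotients for A
    oscillate between two different values (implies_order_le).

    In the other direction, a limit for B at order n yields limits for each of
    the two components of B and for their dilates, hence for both components of
    A (cvg_component), and a difference is the sum of its two components. *)

Set Implicit Arguments.
Unset Strict Implicit.
Unset Printing Implicit Defensive.

Import Order.TTheory GRing.Theory Num.Theory.
Import numFieldNormedType.Exports.
Local Open Scope ring_scope.

(** * Linear forms separating a vector from a subspace *)

Definition submodule (K : fieldType) (V : lmodType K) (M : set V) : Prop :=
  M 0 /\ forall (a : K) x y, M x -> M y -> M (a *: x + y).

Lemma submoduleB (K : fieldType) (V : lmodType K) (M : set V) (x y : V) :
  submodule M -> M x -> M y -> M (x - y).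
Proof. by move=> [_ hM] Mx My; rewrite addrC -scaleN1r; exact: hM. Qed.

Lemma submoduleZ (K : fieldType) (V : lmodType K) (M : set V) (a : K) (x : V) :
  submodule M -> M x -> M (a *: x).
Proof. by move=> [M0 hM] Mx; rewrite -[a *: x]addr0; exact: hM. Qed.

(** A subspace that is maximal among those containing W but not v is a
    hyperplane supplementary to the line of v: adding any vector outside it
    brings v in. The chains are taken among sets X such that the union of X and
    W is a subspace, rather than among subspaces containing W, so that the empty
    chain also has an upper bound. *)
Lemma separating_hyperplane (K : fieldType) (V : lmodType K) (W : set V) (v : V) :
  submodule W -> ~ W v ->
  exists M : set V, [/\ submodule M, (W `<=` M)%classic, ~ M v &
    forall u, exists c : K, M (u - c *: v)].
Proof.
move=> sW Wv.
pose P (X : set V) := submodule (X `|` W)%classic /\ ~ (X `|` W)%classic v.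
have [X [[sX Xv] Xmax]] : exists X, P X /\ forall Y, (X `<` Y)%classic -> ~ P Y.
  apply: Zorn_bigcup => F FP Ftot; split; first split.
  - by right; case: sW.
  - move=> a x y.
    (* two members of the union already lie in a common member of the chain *)
    have sub X : F X -> ((X `|` W) `<=` (\bigcup_(Y in F) Y) `|` W)%classic.
      by move=> FX z [Xz|Wz]; [left; exists X|right].
    move=> [[X FX Xx]|Wx] [[Y FY Yy]|Wy].
    + have [XY|YX] := Ftot X Y FX FY.
      * by apply: (sub Y FY); apply: (FP Y FY).1.2; left => //; exact: XY.
      * by apply: (sub X FX); apply: (FP X FX).1.2; left => //; exact: YX.
    + by apply: (sub X FX); apply: (FP X FX).1.2; [left|right].
    + by apply: (sub Y FY); apply: (FP Y FY).1.2; [right|left].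
    + by right; exact: sW.2.
  - by move=> [[X FX Xv]|//]; apply: (FP X FX).2; left.
exists (X `|` W)%classic; split => //.
move=> u; have [Mu|Mu] := pselect ((X `|` W)%classic u).
  by exists 0; rewrite scale0r subr0.
pose Y : set V := [set z | exists c : K, (X `|` W)%classic (z - c *: u)]%classic.
have XY : (X `|` W `<=` Y)%classic by move=> z Mz; exists 0; rewrite scale0r subr0.
have Yu : Y u by exists 1; rewrite scale1r subrr; exact: sX.1.
have YW : (Y `|` W)%classic = Y.
  by apply/seteqP; split => [z [//|Wz]|z Yz]; [apply: XY; right|left].
have sY : submodule Y.
  split; first by apply: XY; exact: sX.1.
  move=> a x y [c hc] [d hd]; exists (a * c + d).
  suff -> : a *: x + y - (a * c + d) *: u = a *: (x - c *: u) + (y - d *: u).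
    exact: sX.2.
  by rewrite scalerDl scalerBr scalerA opprD addrACA.
have Yv : Y v.
  apply: contrapT => Yv; apply: (Xmax Y); last by split; rewrite YW.
  split; last by move=> h; apply: Mu; left; exact: h.
  by move=> z Xz; apply: XY; left.
case: Yv => d hd.
have d0 : d != 0 by apply/eqP => d0; apply: Xv; move: hd; rewrite d0 scale0r subr0.
exists d^-1.
have -> : u - d^-1 *: v = (- d^-1) *: (v - d *: u).
  by rewrite scalerBr scalerA mulNr mulVf// !scaleNr scale1r opprK addrC.
exact: submoduleZ.
Qed.

Lemma separating_functional (K : fieldType) (V : lmodType K) (W : set V) (v : V) :
  submodule W -> ~ W v ->
  exists phi : V -> K, [/\ forall a x y, phi (a *: x + y) = a * phi x + phi y,
    forall w, W w -> phi w = 0 & phi v = 1].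
Proof.
move=> sW /(separating_hyperplane sW)[M [sM WM Mv hM]].
have uniq_coord u c d : M (u - c *: v) -> M (u - d *: v) -> c = d.
  move=> hc hd; apply/eqP; rewrite -subr_eq0; apply/negPn/negP => cd.
  apply: Mv; rewrite -[v](scalerK cd); apply: submoduleZ => //.
  have -> : (c - d) *: v = (u - d *: v) - (u - c *: v).
    by rewrite scalerBl opprB [RHS]addrC addrA subrK.
  exact: submoduleB.
pose phi u := projT1 (cid (hM u)).
have phiP u : M (u - phi u *: v) := projT2 (cid (hM u)).
exists phi; split.
- move=> a x y; apply: uniq_coord (phiP _) _.
  suff -> : a *: x + y - (a * phi x + phi y) *: v =
      a *: (x - phi x *: v) + (y - phi y *: v) by exact: sM.2.
  by rewrite scalerDl scalerBr scalerA opprD addrACA.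
- by move=> w Ww; apply: uniq_coord (phiP w) _; rewrite scale0r subr0; exact: WM.
- by apply: uniq_coord (phiP v) _; rewrite scale1r subrr; exact: sM.1.
Qed.

(** The algebraic duality behind the whole proof: an element outside the span of
    a family is detected by a linear form vanishing on that family. *)
Lemma span_or_functional (K : fieldType) (V : lmodType K) (T : Type) (w : T -> V) (v : V) :
  (exists s : seq (K * T), v = \sum_(j <- s) j.1 *: w j.2) \/
  (exists phi : V -> K, [/\ forall a x y, phi (a *: x + y) = a * phi x + phi y,
    forall t, phi (w t) = 0 & phi v = 1]).
Proof.
pose W : set V := [set x | exists s : seq (K * T), x = \sum_(j <- s) j.1 *: w j.2]%classic.
have [|Wv] := pselect (W v); first by left.
right; have sW : submodule W.
  split; first by exists [::]; rewrite big_nil.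
  move=> a x y [s ->] [s' ->]; exists ([seq (a * j.1, j.2) | j <- s] ++ s').
  rewrite big_cat big_map /= scaler_sumr; congr (_ + _).
  by apply: eq_bigr => j _; rewrite scalerA.
have [phi [lin phiW phiv]] := separating_functional sW Wv.
exists phi; split => // t; apply: phiW; exists [:: (1, t)].
by rewrite big_seq1 scale1r.
Qed.


(** * A scale multiplicatively independent of the nodes *)

Definition mul_subgroup (R : realType) (H : set R) : Prop :=
  [/\ ~ H 0, H 1 & forall x y, H x -> H y -> H (x / y)].

(** A countable set has Lebesgue measure zero, the unit interval does not. *)
Lemma countable_avoid (R : realType) (A : set R) :
  countable A -> exists t, [/\ 0 < t, t < 1 & ~ A t].
Proof.
move=> cA; apply: contrapT => hA.
have sub : (`]0%R, 1%R[ `<=` A)%classic.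
  move=> t /=; rewrite in_itv /= => /andP[t0 t1].
  by apply: contrapT => At; apply: hA; exists t.
have := countable_lebesgue_measure0 (sub_countable (subset_card_le sub) cA).
rewrite lebesgue_measure_itv /= lte_fin ltr01 oppr0 adde0 => /eqP.
by rewrite eqe oner_eq0.
Qed.

(** Words in the letters of s and their inverses, the boolean telling which; they
    enumerate the generated subgroup by a countable type. Letters out of range
    stand for 1. *)
Definition word_eval (R : realType) (s : seq R) (w : seq (nat * bool)) : R :=
  \prod_(p <- w) (if p.2 then nth 1 s p.1 else (nth 1 s p.1)^-1).

Lemma word_eval_subgroup (R : realType) (s : seq R) :
  all (predC1 0) s -> mul_subgroup (range (word_eval s)).
Proof.
move=> s0; have nz i : nth 1 s i != 0.
  have [lt_i|le_i] := ltnP i (size s); first exact: (all_nthP 1 s0).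
  by rewrite nth_default// oner_neq0.
have wnz w : word_eval s w != 0.
  rewrite prodf_seq_neq0; apply/allP => -[i b] _ /=.
  by case: b; rewrite ?invr_eq0 nz.
split.
- by move=> [w _ /eqP]; rewrite (negbTE (wnz w)).
- by exists [::] => //; rewrite /word_eval big_nil.
- move=> _ _ [w _ <-] [w' _ <-]; exists (w ++ [seq (p.1, ~~ p.2) | p <- w']) => //.
  rewrite /word_eval big_cat big_map /= -prodfV; congr (_ * _).
  by apply: eq_bigr => -[i []] _ /=; rewrite ?invrK.
Qed.

(** The subgroup H generated by the nonzero entries of s is countable, hence so is
    the set of all roots of its elements; t is taken outside the latter. *)
Lemma independent_scale (R : realType) (s : seq R) :
  exists (H : set R) (t : R), [/\ mul_subgroup H,
    forall x, x \in s -> x != 0 -> H x, 0 < t, t < 1 &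
    forall k, (0 < k)%N -> ~ H (t ^+ k)].
Proof.
pose s' := [seq x <- s | x != 0].
have all0 : all (predC1 0) s' by apply/allP => x; rewrite mem_filter => /andP[].
pose root (q : nat * seq (nat * bool)) := word_eval s' q.2 `^ (q.1%:R^-1).
have [t [t0 t1 tA]] : exists t, [/\ 0 < t, t < 1 & ~ range root t].
  apply: countable_avoid; apply: sub_countable (card_image_le _ _) _.
  exact: countableP.
exists (range (word_eval s')), t; split => //.
- exact: word_eval_subgroup.
- move=> x xs x0; have xs' : x \in s' by rewrite mem_filter x0.
  exists [:: (index x s', true)] => //.
  by rewrite /word_eval big_seq1 /= nth_index.
- move=> k k0 [w _ hw]; apply: tA; exists (k, w) => //.
  rewrite /root /= hw -powR_mulrn ?ltW// -powRrM mulfV ?powRr1 ?ltW//.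
  by rewrite pnatr_eq0 -lt0n.
Qed.


(** * Copying a function onto infinitely many cosets *)

(** The restriction of f to H, copied onto the cosets t^k H. By layers_disjoint
    the chosen exponent is the only possible one. *)
Definition spread (R : realType) (H : set R) (t : R) (f : R -> R) (y : R) : R :=
  if pselect (exists k : nat, H (y / t ^+ k)) is left e
  then f (y / t ^+ projT1 (cid e)) else 0.

Lemma mul_subgroupV (R : realType) (H : set R) (x : R) :
  mul_subgroup H -> H x -> H x^-1.
Proof. by move=> [_ H1 Hd] Hx; rewrite -div1r; exact: Hd. Qed.

Lemma mul_subgroupM (R : realType) (H : set R) (x y : R) :
  mul_subgroup H -> H x -> H y -> H (x * y).
Proof.
move=> sH Hx Hy; rewrite -[y]invrK; have [_ _ Hd] := sH.
by apply: Hd => //; exact: mul_subgroupV.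
Qed.

(** If y were in t^j H and in t^k H with j < k, the quotient t^(k - j) would be in
    H. *)
Lemma layers_disjoint (R : realType) (H : set R) (t : R) :
  mul_subgroup H -> 0 < t -> (forall k, (0 < k)%N -> ~ H (t ^+ k)) ->
  forall y j k, H (y / t ^+ j) -> H (y / t ^+ k) -> j = k.
Proof.
move=> sH t0 tH y j k.
wlog jk : j k / (j <= k)%N.
  by move=> hw; have [/hw//|/ltnW/hw {}hw hj hk] := leqP j k; rewrite hw.
move=> hj hk; have [//|jltk] := eqVneq j k; exfalso.
have [H0 _ Hd] := sH.
have y0 : y != 0 by apply/eqP => y0; apply: H0; rewrite y0 mul0r in hj.
apply: (tH (k - j)%N); first by rewrite subn_gt0 ltn_neqAle jltk.
suff -> : t ^+ (k - j) = (y / t ^+ j) / (y / t ^+ k) by exact: Hd.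
by rewrite invf_div mulrC mulrA divfK// expfB_cond// gt_eqF.
Qed.

Section Spread.
Variables (R : realType) (H : set R) (t : R) (f : R -> R).
Hypotheses (sH : mul_subgroup H) (t0 : 0 < t).
Hypothesis tH : forall k, (0 < k)%N -> ~ H (t ^+ k).
Hypothesis f0 : f 0 = 0.

Lemma spread_layer k y : H (y / t ^+ k) -> spread H t f y = f (y / t ^+ k).
Proof.
move=> Hy; rewrite /spread; case: pselect => [e|]; last by case; exists k.
by case: cid => j /= Hj; rewrite (layers_disjoint sH t0 tH Hj Hy).
Qed.

Lemma spread_out y : ~ (exists k, H (y / t ^+ k)) -> spread H t f y = 0.
Proof. by rewrite /spread; case: pselect. Qed.

Lemma spread0 : spread H t f 0 = 0.
Proof. by rewrite spread_out// => -[k]; rewrite mul0r; case: sH. Qed.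

Variable D : difference R.
Hypothesis nodeH : forall i : 'I_(dsize D), node i != 0 -> H (node i).

(** Multiplication by a nonzero node preserves the coset of h, and a zero node
    sees the value 0 for both functions. *)
Lemma Delta_spread_layer k h :
  H (h / t ^+ k) -> Delta D (spread H t f) 0 h = Delta D f 0 (h / t ^+ k).
Proof.
move=> Hh; apply: eq_bigr => i _; rewrite !add0r; congr (_ * _).
have [->|ai0] := eqVneq (node i) 0; first by rewrite !mul0r spread0 f0.
by rewrite mulrA -spread_layer// -mulrA; apply: mul_subgroupM => //; exact: nodeH.
Qed.

Lemma Delta_spread_out h :
  ~ (exists k, H (h / t ^+ k)) -> Delta D (spread H t f) 0 h = 0.
Proof.
move=> Hh; rewrite /Delta big1// => i _; rewrite add0r.
have [->|ai0] := eqVneq (node i) 0; first by rewrite !mul0r spread0 mulr0.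
rewrite spread_out ?mulr0// => -[k Hk]; apply: Hh; exists k.
have -> : h / t ^+ k = (node i * h / t ^+ k) / node i.
  by rewrite [RHS]mulrC -mulrA mulKf.
by have [_ _ Hd] := sH; apply: Hd => //; exact: nodeH.
Qed.

(** For a step h in some t^k H the difference is that of f at a rescaled step; for
    any other h, the spread function vanishes at all points involved. *)
Lemma Delta_spread_eq0 h :
  (forall h, Delta D f 0 h = 0) -> Delta D (spread H t f) 0 h = 0.
Proof.
move=> hf; have [[k Hk]|Hh] := pselect (exists k, H (h / t ^+ k)).
  by rewrite (Delta_spread_layer Hk).
exact: Delta_spread_out.
Qed.

(** The value at step 1 is reproduced at steps tending to 0: this turns an
    algebraic obstruction into a failure of differentiability. *)
Lemma Delta_spread_pow k : Delta D (spread H t f) 0 (t ^+ k) = Delta D f 0 1.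
Proof.
have tk : t ^+ k / t ^+ k = 1 by rewrite divff// expf_neq0// gt_eqF.
by rewrite (@Delta_spread_layer k) tk//; case: sH.
Qed.

End Spread.

(** * Limits at a punctured point *)

Lemma cvg_comp_dnbhs0 (R : realType) (T : Type) (F : set_system T) {FF : Filter F}
    (q : T -> R) (g : R -> R) (l : R) :
  (q x @[x --> F] --> (0 : R))%classic -> (\forall x \near F, q x != 0)%classic ->
  (g h @[h --> (0 : R)^'] --> l)%classic -> (g (q x) @[x --> F] --> l)%classic.
Proof.
move=> q0 qn0 gl P /gl /q0 Pq.
by apply: (@filterS2 _ F _ _ _ _ _ qn0 Pq) => x qx; apply.
Qed.

Lemma cvg_along_geometric (R : realType) (g : R -> R) (l c t : R) :
  (g h @[h --> (0 : R)^'] --> l)%classic -> c != 0 -> 0 < t -> t < 1 ->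
  (g (c * t ^+ k) @[k --> \oo] --> l)%classic.
Proof.
move=> gl c0 t0 t1; apply: cvg_comp_dnbhs0 gl.
  have : (c * t ^+ k @[k --> \oo] --> c * 0)%classic.
    by apply: cvgMl_tmp; apply: cvg_expr; rewrite gtr0_norm.
  by rewrite mulr0.
by apply: nearW => k; rewrite mulf_neq0// expf_neq0// gt_eqF.
Qed.

Lemma cvg_dilation (R : realType) (g : R -> R) (l u : R) :
  u != 0 -> (g h @[h --> (0 : R)^'] --> l)%classic ->
  (g (u * h) @[h --> (0 : R)^'] --> l)%classic.
Proof.
move=> u0; apply: cvg_comp_dnbhs0.
  have : (u * h @[h --> (0 : R)^'] --> u * 0)%classic.
    by apply: cvgMl_tmp; exact: cvg_within.
  by rewrite mulr0.
near=> h; rewrite mulf_neq0//; near: h; exact: nbhs_dnbhs_neq.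
Unshelve. all: end_near. Qed.

Lemma not_cvg_inv_pow (R : realType) (m : nat) (t l : R) :
  (0 < m)%N -> 0 < t -> t < 1 ->
  ~ (((t ^+ k) ^+ m)^-1 @[k --> \oo] --> l)%classic.
Proof.
move=> m0 t0 t1 hl.
have tm0 : ((t ^+ k) ^+ m @[k --> \oo] --> (0 : R))%classic.
  under eq_fun do rewrite exprAC.
  by apply: cvg_expr; rewrite ger0_norm ?exprn_ge0 ?ltW// exprn_ilt1 ?ltW// -lt0n.
have h0 : ((t ^+ k) ^+ m * ((t ^+ k) ^+ m)^-1 @[k --> \oo] --> 0 * l)%classic.
  exact: cvgM.
have cst1 : (fun k => (t ^+ k) ^+ m * ((t ^+ k) ^+ m)^-1) = cst (1 : R).
  by apply/funext => k /=; rewrite divff// !expf_neq0// gt_eqF.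
have h1 : (cst (1 : R) @ \oo --> (1 : R))%classic by exact: cvg_cst.
rewrite cst1 mul0r in h0.
have e : 1 = 0 :> R by exact: cvg_unique h1 h0.
by move/eqP: e; rewrite oner_eq0.
Qed.


(** * Parity components of a difference *)

(** Indexing the components by a boolean, true being odd, treats both of them
    (and both parities of the order) at once. *)
Definition Delta_parity (R : realType) (s : bool) (D : difference R) :
    (R -> R) -> R -> R -> R :=
  if s then Delta_odd D else Delta_ev D.

Lemma Delta_epsE (R : realType) (n : nat) (D : difference R) :
  Delta_eps n D = Delta_parity (odd n) D.
Proof. by []. Qed.

Lemma Delta_eps'E (R : realType) (n : nat) (D : difference R) :
  Delta_eps' n D = Delta_parity (~~ odd n) D.
Proof. by rewrite /Delta_eps' /Delta_parity; case: odd. Qed.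

Lemma Delta_parityE (R : realType) (s : bool) (D : difference R) f x h :
  Delta_parity s D f x h =
  2^-1 * (Delta D f x h + (-1) ^+ s * Delta D f x (- h)).
Proof. by case: s; rewrite /= ?mulN1r ?mul1r. Qed.

Lemma Delta_parity_split (R : realType) (D : difference R) f x h :
  Delta D f x h = Delta_parity true D f x h + Delta_parity false D f x h.
Proof. by rewrite !Delta_parityE /=; field. Qed.

Lemma Delta_rebase (R : realType) (D : difference R) f x h u :
  Delta D (fun y => f (x + y * h)) 0 u = Delta D f x (u * h).
Proof. by apply: eq_bigr => i _; rewrite add0r mulrA. Qed.

Lemma Delta_parity_rebase (R : realType) (s : bool) (D : difference R) f x h u :
  Delta_parity s D (fun y => f (x + y * h)) 0 u = Delta_parity s D f x (u * h).
Proof. by rewrite !Delta_parityE !Delta_rebase mulNr. Qed.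

Definition parity_part (R : realType) (s : bool) (f : R -> R) (y : R) : R :=
  2^-1 * (f y + (-1) ^+ s * f (- y)).

(** A component of a difference sees only the part of the function that has the
    same parity, and on that part it agrees with the full difference. *)
Lemma Delta_parity_part (R : realType) (s : bool) (D : difference R) f h :
  Delta_parity s D f 0 h = Delta D (parity_part s f) 0 h.
Proof.
rewrite Delta_parityE mulr_sumr -big_split mulr_sumr; apply: eq_bigr => i _ /=.
by rewrite /parity_part !add0r mulrN; ring.
Qed.

Lemma Delta_sub_const (R : realType) (n : nat) (D : difference R) f c x h :
  generalized_Riemann n D -> Delta D (fun y => f y - c) x h = Delta D f x h.
Proof.
move=> [n0 hD]; rewrite /Delta.
under eq_bigr do rewrite mulrBr.
rewrite sumrB -mulr_suml -[RHS]subr0; congr (_ - _).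
have := hD 0%N (leq0n n).
under eq_bigr do rewrite expr0 mulr1.
by move=> ->; rewrite ltn_eqF// mulr0 mul0r.
Qed.

(** On the monomial of degree m, the component of the parity of m computes the
    moment of degree m, and so does each of its dilates up to a factor. *)
Lemma Delta_parity_pow (R : realType) (m : nat) (D : difference R) h :
  Delta_parity (odd m) D (fun y => y ^+ m) 0 h =
  h ^+ m * \sum_(i < dsize D) coef i * node i ^+ m.
Proof.
have E k : Delta D (fun y => y ^+ m) 0 k = k ^+ m * \sum_(i < dsize D) coef i * node i ^+ m.
  by rewrite mulr_sumr; apply: eq_bigr => i _; rewrite add0r exprMn; ring.
rewrite Delta_parityE !E signr_odd (exprNn h) !mulrA -exprMn mulrNN mulr1 expr1n mul1r.
by field.
Qed.

(** * Functions obtained from linear forms on functionals *)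

(** A linear form phi on the space of functionals determines the function
    y |-> phi (evaluation at y); as differences are combinations of evaluations,
    applying one to this function amounts to applying phi to the difference. *)
Section Functional.
Variables (R : realType) (phi : ((R -> R) -> R^o) -> R).
Hypothesis lin : forall a x y, phi (a *: x + y) = a * phi x + phi y.

Lemma functional0 : phi 0 = 0.
Proof. by have := lin (-1) 0 0; rewrite scaler0 addr0 mulN1r addNr. Qed.

Lemma functionalZ a x : phi (a *: x) = a * phi x.
Proof. by rewrite -[a *: x]addr0 lin functional0 addr0. Qed.

Lemma Delta_functional (D : difference R) h :
  Delta D (fun y => phi (fun g => g y)) 0 h = phi (fun g => Delta D g 0 h).
Proof.
have -> : (fun g => Delta D g 0 h) =
    \sum_(i < dsize D) (coef i : R) *: ((fun g => g (0 + node i * h)) : (R -> R) -> R^o).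
  by apply/funext => g; rewrite fct_sumE; apply: eq_bigr.
apply: (big_rec2 (fun a b => a = phi b)) => [|i a b _ ->]; first by rewrite functional0.
by rewrite lin.
Qed.

Lemma Delta_parity_functional (s : bool) (D : difference R) h :
  Delta_parity s D (fun y => phi (fun g => g y)) 0 h =
  phi (fun g => Delta_parity s D g 0 h).
Proof.
rewrite Delta_parityE !Delta_functional.
have -> : (fun g => Delta_parity s D g 0 h) = (2^-1 : R) *:
    (((-1) ^+ s : R) *: ((fun g => Delta D g 0 (- h)) : (R -> R) -> R^o) +
     (fun g => Delta D g 0 h)).
  by apply/funext => g; rewrite Delta_parityE [_ + _]addrC.
by rewrite functionalZ lin [in RHS]addrC.
Qed.

End Functional.

(** * Necessity of the identities *)

(** Otherwise a function annihilated by B but not by A would exist, and its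
    copies at the scales t^k would be B-differentiable with derivative 0 and not
    A-differentiable. *)
Lemma component_in_span (R : realType) (m n : nat) (A B : difference R) (s : bool) :
  generalized_Riemann m A -> generalized_Riemann n B ->
  differentiation_implies n B m A ->
  exists (p : nat) (U u : 'I_p -> R), (forall i, u i != 0) /\
    forall (f : R -> R) (x h : R),
      Delta_parity s A f x h = \sum_(i < p) U i * Delta_parity s B f x (u i * h).
Proof.
move=> hA hB imp.
pose w (u : {u : R | u != 0}) : (R -> R) -> R^o :=
  fun g => Delta_parity s B g 0 (val u).
pose v : (R -> R) -> R^o := fun g => Delta_parity s A g 0 1.
case: (span_or_functional w v) => [[S hS]|[phi [lin phiw phiv]]].
  exists (size S), (fun i => (tnth (in_tuple S) i).1),
    (fun i => val (tnth (in_tuple S) i).2); split; first by move=> i; case: (tnth _ i).2.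
  move=> f x h; have -> : Delta_parity s A f x h = v (fun y => f (x + y * h)).
    by rewrite /v Delta_parity_rebase mul1r.
  rewrite hS fct_sumE big_tnth; apply: eq_bigr => i _.
  by rewrite -Delta_parity_rebase.
exfalso.
(* The parity part makes the whole of B vanish, not just one component; the
   subtraction gives f 0 = 0, which the spreading requires and which settles
   the step 0, absent from the family w. *)
pose f0 := parity_part s (fun y => phi (fun g => g y)).
pose f y := f0 y - f0 0.
have f00 : f 0 = 0 by rewrite /f subrr.
have fB h : Delta B f 0 h = 0.
  have [->|h0] := eqVneq h 0.
    by apply: big1 => i _; rewrite mulr0 addr0 f00 mulr0.
  rewrite (Delta_sub_const _ _ _ _ hB)// -Delta_parity_part Delta_parity_functional//.
  exact: (phiw (exist _ h h0)).
have fA : Delta A f 0 1 = 1.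
  by rewrite (Delta_sub_const _ _ _ _ hA)// -Delta_parity_part Delta_parity_functional.
pose nodes (D : difference R) := [seq node i | i <- enum 'I_(dsize D)].
have [H [t [sH nodeH t0 t1 tH]]] := independent_scale (nodes A ++ nodes B).
have HA (i : 'I_(dsize A)) : node i != 0 -> H (node i).
  by apply: nodeH; rewrite mem_cat map_f ?mem_enum.
have HB (i : 'I_(dsize B)) : node i != 0 -> H (node i).
  by apply: nodeH; rewrite mem_cat orbC map_f ?mem_enum.
have [|l hl] := imp (spread H t f) 0.
  exists 0; rewrite (_ : (fun h => _) = cst 0); first exact: cvg_cst.
  by apply/funext => h; rewrite (Delta_spread_eq0 sH t0 tH f00 HB)// mul0r.
apply: (@not_cvg_inv_pow _ m t l) => //; first by case: hA.
have := cvg_along_geometric hl (oner_neq0 _) t0 t1.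
rewrite (_ : (fun k => _) = (fun k => ((t ^+ k) ^+ m)^-1))//.
apply/funext => k; rewrite mul1r (Delta_spread_pow sH t0 tH f00 HA).
by rewrite fA mul1r.
Qed.

(** * Equality of the orders *)

(** Test the identity on the monomial of degree m: the left side is m!, and the
    right side would vanish if m < n. *)
Lemma span_order_le (R : realType) (m n : nat) (A B : difference R)
    (p : nat) (U u : 'I_p -> R) :
  generalized_Riemann m A -> generalized_Riemann n B ->
  (forall (f : R -> R) (x h : R), Delta_parity (odd m) A f x h =
     \sum_(i < p) U i * Delta_parity (odd m) B f x (u i * h)) ->
  (n <= m)%N.
Proof.
move=> [_ hA] [_ hB] /(_ (fun y => y ^+ m) 0 1).
rewrite Delta_parity_pow hA// eqxx mulr1 expr1n mul1r leqNgt => hAB.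
apply/negP => mn; move: hAB; rewrite big1 => [|i _].
  by move/eqP; rewrite pnatr_eq0 -leqn0 leqNgt fact_gt0.
have mn0 : (m == n)%:R = 0 :> R by rewrite (ltn_eqF mn).
by rewrite Delta_parity_pow (hB m (ltnW mn)) mn0 [_ * 0]mulr0 [_ * 0]mulr0 mulr0.
Qed.


Definition lacunary_power (R : realType) (m : nat) (t : R) (y : R) : R :=
  if `[< exists k : nat, y = t ^+ k.*2 >] then y ^+ m else 0.

(** The function is bounded by the m-th power of the absolute value, hence is
    o(y^n) when n < m, and a finite combination of dilates of it is o(h^n). *)
Lemma lacunary_power_differentiable (R : realType) (m n : nat) (B : difference R) (t : R) :
  (n < m)%N -> gR_differentiable n B (lacunary_power m t) 0.
Proof.
move=> nm; exists 0.
pose C : R := \sum_(i < dsize B) `|coef i * node i ^+ m|.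
have C0 : 0 <= C by apply: sumr_ge0.
have bound h : `|Delta B (lacunary_power m t) 0 h| <= C * `|h| ^+ m.
  rewrite /Delta mulr_suml; apply: le_trans (ler_norm_sum _ _ _) _.
  apply: ler_sum => i _; rewrite add0r /lacunary_power.
  case: asboolP => _; last by rewrite mulr0 normr0 mulr_ge0 ?exprn_ge0.
  by rewrite exprMn mulrA normrM normrX.
apply/cvgr0Pnorm_le => e e0; near=> h.
have h0 : h != 0 by near: h; exact: nbhs_dnbhs_neq.
have h1 : `|h| <= 1 by near: h; exact: dnbhs0_le.
have he : `|h| <= e / (C + 1).
  by near: h; apply: dnbhs0_le; rewrite divr_gt0// ltr_wpDl.
have hn : 0 < `|h| ^+ n by rewrite exprn_gt0 ?normr_gt0.
rewrite normrM normfV normrX ler_pdivrMr//; apply: le_trans (bound h) _.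
have -> : `|h| ^+ m = `|h| * `|h| ^+ (m - n.+1) * `|h| ^+ n.
  by rewrite mulrAC -exprS -exprD subnKC.
rewrite mulrA ler_pM2r//.
apply: (@le_trans _ _ (C * (e / (C + 1)))).
  apply: ler_wpM2l => //; apply: le_trans he.
  by rewrite ler_piMr// exprn_ile1.
rewrite mulrCA ler_piMr ?(ltW e0)// ler_pdivrMr ?ltr_wpDl//.
by rewrite mul1r lerDl.
Unshelve. all: end_near. Qed.

(** Let a be a node contributing to the moment of degree m. For h = t^(2k) / a,
    independence of t forces every other node off the lacunary set, so that the
    quotient is the contribution of a. For h = t^(2k+1), parity of the exponents
    forces all nodes off it, and the quotient is 0. *)
Lemma lacunary_power_not_differentiable (R : realType) (m : nat) (A : difference R)
    (H : set R) (t : R) :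
  generalized_Riemann m A -> mul_subgroup H -> 0 < t -> t < 1 ->
  (forall k, (0 < k)%N -> ~ H (t ^+ k)) ->
  (forall i : 'I_(dsize A), node i != 0 -> H (node i)) ->
  ~ gR_differentiable m A (lacunary_power m t) 0.
Proof.
move=> [m0 hA] sH t0 t1 tH nodeH [l hl].
have [H0 H1 Hd] := sH.
have tn0 k : t ^+ k != 0 by rewrite expf_neq0// gt_eqF.
have [i0 ai0] : exists i : 'I_(dsize A), coef i * node i ^+ m != 0.
  apply: contrapT => none; have := hA m (leqnn m).
  rewrite eqxx mulr1 big1 => [/esym/eqP|i _].
    by rewrite pnatr_eq0 -leqn0 leqNgt fact_gt0.
  by apply: contrapT => /eqP ai; apply: none; exists i.
have n0 : node i0 != 0.
  by apply: contraNneq ai0 => ->; rewrite expr0n gtn_eqF// mulr0.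
pose a := node i0.
pose g h := Delta A (lacunary_power m t) 0 h / h ^+ m.
have gE h : h != 0 -> g h = \sum_(i < dsize A)
    (if `[< exists k, node i * h = t ^+ k.*2 >] then coef i * node i ^+ m else 0).
  move=> h0; rewrite /g mulr_suml; apply: eq_bigr => i _.
  rewrite add0r /lacunary_power; case: asboolP => _; last by rewrite mulr0 mul0r.
  by rewrite exprMn mulrA mulfK// expf_neq0.
have T0 : 0 < t ^+ 2 by rewrite exprn_gt0.
have T1 : t ^+ 2 < 1 by rewrite exprn_ilt1 ?ltW.
have lim_on : l = coef i0 * node i0 ^+ m.
  have hc := cvg_along_geometric (g := g) hl (invr_neq0 n0) T0 T1.
  rewrite (_ : (fun k => _) = cst (coef i0 * node i0 ^+ m)) in hc.
    by apply: (cvg_unique (@norm_hausdorff _ _) hc); exact: cvg_cst.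
  apply/funext => k /=; rewrite -exprM mul2n gE ?mulf_neq0 ?invr_eq0//.
  rewrite (bigD1 i0)//= mulrA divff// mul1r; case: asboolP; last by case; exists k.
  move=> _; rewrite big1 ?addr0// => i ii0; case: asboolP => // -[j hj]; exfalso.
  have ni0 : node i != 0.
    by apply/eqP => ni0; move/eqP: hj; rewrite ni0 mul0r eq_sym (negbTE (tn0 _)).
  have kj : k.*2 = j.*2.
    apply: (@layers_disjoint _ _ _ sH t0 tH (t ^+ j.*2)); last by rewrite divff.
    by rewrite -hj mulrA mulfK//; apply: Hd; exact: nodeH.
  have q1 : node i / a = 1.
    by apply: (mulIf (tn0 k.*2)); rewrite mul1r -mulrA hj kj.
  by move/eqP: ii0; apply; apply: node_inj; exact: divr1_eq.
have lim_off : l = 0.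
  have hc := cvg_along_geometric (g := g) hl (lt0r_neq0 t0) T0 T1.
  rewrite (_ : (fun k => _) = cst 0) in hc.
    by apply: (cvg_unique (@norm_hausdorff _ _) hc); exact: cvg_cst.
  apply/funext => k /=; rewrite -exprM mul2n -exprS gE//.
  rewrite big1// => i _; case: asboolP => // -[j hj]; exfalso.
  have ni0 : node i != 0.
    by apply/eqP => ni0; move/eqP: hj; rewrite ni0 mul0r eq_sym (negbTE (tn0 _)).
  have kj : k.*2.+1 = j.*2.
    apply: (@layers_disjoint _ _ _ sH t0 tH (t ^+ j.*2)); last by rewrite divff.
    by rewrite -hj mulfK//; exact: nodeH.
  by have := congr1 odd kj; rewrite /= !odd_double.
by move/eqP: lim_on; rewrite lim_off eq_sym (negbTE ai0).
Qed.

Lemma implies_order_le (R : realType) (m n : nat) (A B : difference R) :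
  generalized_Riemann m A -> differentiation_implies n B m A -> (m <= n)%N.
Proof.
move=> hA imp; rewrite leqNgt; apply/negP => nm.
have [H [t [sH nodeH t0 t1 tH]]] :=
  independent_scale [seq node i | i <- enum 'I_(dsize A)].
apply: (lacunary_power_not_differentiable hA sH t0 t1 tH) => //.
  by move=> i; apply: nodeH; rewrite map_f ?mem_enum.
exact/imp/lacunary_power_differentiable.
Qed.

(** * Sufficiency of the identities *)

(** Steps of both signs tend to 0 in the definition of the derivative, so that
    u h and - u h may be used separately; a dilation only rescales the limit. *)
Lemma cvg_Delta_parity (R : realType) (n : nat) (B : difference R) (s : bool)
    (f : R -> R) (x u : R) :
  u != 0 -> gR_differentiable n B f x ->
  exists l : R, (Delta_parity s B f x (u * h) / h ^+ n @[h --> (0 : R)^'] --> l)%classic.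
Proof.
move=> u0 [l hl].
have part w : w != 0 ->
    (Delta B f x (w * h) / h ^+ n @[h --> (0 : R)^'] --> l * w ^+ n)%classic.
  move=> w0.
  rewrite (_ : (fun h => _) = (fun h => Delta B f x (w * h) / (w * h) ^+ n * w ^+ n)).
    by apply: cvgMr_tmp; apply: (cvg_dilation (g := fun h => Delta B f x h / h ^+ n)).
  by apply/funext => h; rewrite exprMn invfM [(w ^+ n)^-1 * _]mulrC mulrA divfK ?expf_neq0.
exists (2^-1 * (l * u ^+ n + (-1) ^+ s * (l * (- u) ^+ n))).
rewrite (_ : (fun h => _) = (fun h => 2^-1 * (Delta B f x (u * h) / h ^+ n +
    (-1) ^+ s * (Delta B f x (- u * h) / h ^+ n)))).
  apply: cvgMl_tmp; apply: cvgD; first exact: part.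
  by apply: cvgMl_tmp; apply: part; rewrite oppr_eq0.
by apply/funext => h; rewrite Delta_parityE mulNr; ring.
Qed.

Lemma cvg_component (R : realType) (n : nat) (A B : difference R) (s : bool)
    (p : nat) (U u : 'I_p -> R) (f : R -> R) (x : R) :
  (forall i, u i != 0) ->
  (forall h, Delta_parity s A f x h =
     \sum_(i < p) U i * Delta_parity s B f x (u i * h)) ->
  gR_differentiable n B f x ->
  exists l : R, (Delta_parity s A f x h / h ^+ n @[h --> (0 : R)^'] --> l)%classic.
Proof.
move=> u0 hAB hB.
pose limit_is (i : 'I_p) (l : R) :=
  (Delta_parity s B f x (u i * h) / h ^+ n @[h --> (0 : R)^'] --> l)%classic.
have [l hl] := choice (P := limit_is) (fun i => cvg_Delta_parity s (u0 i) hB).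
exists (\sum_(i < p) U i * l i).
rewrite (_ : (fun h => _) = (fun h => \sum_(i < p) U i *
    (Delta_parity s B f x (u i * h) / h ^+ n))).
  by apply: cvg_big => [|i _]; [exact: add_continuous|apply: cvgMl_tmp; exact: hl].
apply/funext => h; rewrite hAB mulr_suml; apply: eq_bigr => i _.
by rewrite mulrA.
Qed.

Theorem theorem3 (R : realType) (m n : nat) (A B : difference R)
    (hA : generalized_Riemann m A) (hB : generalized_Riemann n B) :
  differentiation_implies n B m A <->
  m = n /\
  exists (p q : nat) (U u : 'I_p -> R) (V v : 'I_q -> R),
    (forall i, u i != 0) /\ (forall i, v i != 0) /\
    forall (f : R -> R) (x h : R),
      Delta_eps n A f x h = \sum_(i < p) U i * Delta_eps n B f x (u i * h) /\
      Delta_eps' n A f x h = \sum_(i < q) V i * Delta_eps' n B f x (v i * h).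
Proof.
rewrite !Delta_epsE !Delta_eps'E; split=> [imp|[mn [p [q [U [u [V [v [u0 [v0 hAB]]]]]]]]] f x hf].
  have span s := component_in_span s hA hB imp.
  split.
    apply/eqP; rewrite eqn_leq (implies_order_le hA imp).
    by have [p [U [u [_ hU]]]] := span (odd m); exact: span_order_le hA hB hU.
  have [p [U [u [u0 hU]]]] := span (odd n).
  have [q [V [v [v0 hV]]]] := span (~~ odd n).
  by exists p, q, U, u, V, v.
rewrite mn.
have [l hl] := cvg_component u0 (fun h => (hAB f x h).1) hf.
have [l' hl'] := cvg_component v0 (fun h => (hAB f x h).2) hf.
exists (l + l').
rewrite (_ : (fun h => _) = (fun h => Delta_parity (odd n) A f x h / h ^+ n +
   Delta_parity (~~ odd n) A f x h / h ^+ n)); first exact: cvgD.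
apply/funext => h; rewrite -mulrDl; congr (_ / _).
by rewrite Delta_parity_split; case: odd => //=; rewrite addrC.
Qed.
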